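(* Let $(M,g)$ be a connected Riemannian manifold with $\dim M\geq 3$ and let $r$ be any positive smooth function on $M$. Then $(S_rM,g^S)$ is isometric to $(S_{\frac1r}M,g^{1,r^4})$.
   Context: Let $\pi:TM\to M$ be the tangent bundle, $V=\ker d\pi\cong\pi^*TM$, and let $H$ be the horizontal subbundle of the Levi-Civita connection of $g$, identified with $\pi^*TM$ through $d\pi$, so $TTM=H\oplus V$. For positive smooth functions $f_1,f_2$ on $M$ (composed with $\pi$ when used on $TM$), $g^{f_1,f_2}=f_1\pi^*g\oplus f_2\pi^*g$ with respect to $H\oplus V$, and $g^S=g^{1,1}$ is the Sasaki metric. For a positive smooth function $r$ on $M$, $S_rM=\{u\in TM: g(u,u)=r(\pi(u))^2\}$; tangent sphere bundles carry the metrics induced from the indicated metrics on $TM$. *)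

(* Defs.v *)
From HB Require Import structures.
From mathcomp Require Import all_boot all_order all_algebra.
From mathcomp Require Import all_classical all_reals all_analysis.
Set Implicit Arguments.
Unset Strict Implicit.
Unset Printing Implicit Defensive.
Import Order.TTheory GRing.Theory Num.Theory.
Import numFieldNormedType.Exports.
Local Open Scope classical_set_scope.
Local Open Scope ring_scope.

Fixpoint Ck (R : realType) (V W : normedModType R) (k : nat) (U : set V)
    (f : V -> W) : Prop :=
  match k with
  | 0 => forall x, U x -> {for x, continuous f}
  | k'.+1 => (forall x, U x -> differentiable f x) /\
             (forall v, Ck k' U ('D_v f))
  end.

Definition smooth (R : realType) (V W : normedModType R) (U : set V)
    (f : V -> W) : Prop :=
  forall k, Ck k U f.

(* A family of charts modelled on E, with the inverse parametrizations; the
   points of the space are those of the union of the chart domains, which may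
   be a proper subset of the carrier X (as for [tangent] below).  The values of
   [chart_map i] outside [chart_dom i], and of [chart_inv i] outside [chart_img i],
   are junk. *)
Record charts (R : realType) (E : normedModType R) (X : Type) := Charts {
  chart_idx : Type;
  chart_dom : chart_idx -> set X;
  chart_map : chart_idx -> X -> E;
  chart_inv : chart_idx -> E -> X }.
Arguments chart_idx {R E X}.
Arguments chart_dom {R E X}.
Arguments chart_map {R E X}.
Arguments chart_inv {R E X}.

Section Charts.
Context {R : realType} {E : normedModType R} {X : Type}.
Implicit Types A : charts E X.

Definition points A : set X := [set p | exists i, chart_dom A i p].

Definition chart_img A (i : chart_idx A) : set E :=
  chart_map A i @` chart_dom A i.

Definition transition A (i j : chart_idx A) : E -> E :=
  chart_map A j \o chart_inv A i.

(* A tangent vector is given by its components in all the charts around its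
   base point p, which are related by the differentials of the transition maps;
   the components in the other charts are 0, so that vectors at p are equal as
   soon as they have the same components. *)
Definition fib A : Type := chart_idx A -> E.

Definition is_tangent A (p : X) (v : fib A) : Prop :=
  (forall i, ~ chart_dom A i p -> v i = 0) /\
  (forall i j, chart_dom A i p -> chart_dom A j p ->
     v j = 'd (transition i j) (chart_map A i p) (v i)).

(* the tangent vector at [chart_inv A i x] with component a in the chart i *)
Definition tvec A (i : chart_idx A) (x a : E) : fib A := fun j =>
  if `[< chart_dom A j (chart_inv A i x) >] then 'd (transition i j) x a else 0.

Definition tangent A : charts (E * E)%type (X * fib A)%type := {|
  chart_idx := chart_idx A;
  chart_dom := fun i => [set u | chart_dom A i u.1 /\ @is_tangent A u.1 u.2];
  chart_map := fun i u => (chart_map A i u.1, u.2 i);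
  chart_inv := fun i z => (chart_inv A i z.1, tvec i z.1 z.2) |}.

Definition velocity A (c : R^o -> X) : fib A := fun i =>
  if `[< chart_dom A i (c 0) >] then 'D_1 (chart_map A i \o c) (0 : R^o) else 0.

(* a bilinear form on each tangent space *)
Definition bilinear_field A : Type := X -> fib A -> fib A -> R.

End Charts.
Arguments is_tangent {R E X} A p v.
Arguments velocity {R E X} A c.
Arguments tangent {R E X} A.

Definition real_line (R : realType) : charts R^o R^o := {|
  chart_idx := unit;
  chart_dom := fun=> setT;
  chart_map := fun=> id;
  chart_inv := fun=> id |}.

Section Maps.
Context {R : realType} {E F : normedModType R} {X Y : Type}.
Variables (A : charts E X) (B : charts F Y).

(* smoothness of a map defined on a subset S: near each point of S, it is in
   charts the restriction of a smooth map defined on an open set *)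
Definition smooth_on (S : set X) (f : X -> Y) : Prop :=
  forall p, S p ->
  exists (i : chart_idx A) (j : chart_idx B) (O : set E) (h : E -> F),
    [/\ chart_dom A i p, open O, O (chart_map A i p) & O `<=` chart_img i] /\
    smooth O h /\
    forall x, O x -> S (chart_inv A i x) ->
      chart_dom B j (f (chart_inv A i x)) /\
      chart_map B j (f (chart_inv A i x)) = h x.

Definition tangent_map (f : X -> Y) (u : X * fib A) : Y * fib B :=
  (f u.1, fun j =>
    if `[< chart_dom B j (f u.1) >] then
      match pselect (points A u.1) with
      | left pu => let i := projT1 (cid pu) in
          'd (chart_map B j \o f \o chart_inv A i) (chart_map A i u.1) (u.2 i)
      | right _ => 0
      end
    else 0).

End Maps.

Section Isometry.
Context {R : realType}.

Definition curve_in (E : normedModType R) (X : Type) (A : charts E X)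
    (S : set X) (c : R^o -> X) : Prop :=
  exists2 e : R, 0 < e &
    smooth_on (real_line R) A (ball (0 : R^o) e) c /\
    forall t : R^o, ball 0 e t -> S (c t).

(* Isometry of embedded submanifolds S and S' for the forms induced by G and
   G': a diffeomorphism f pulling G' back to G, where the tangent space of S at
   u consists of the velocities at u of the smooth curves in S, and where the
   differential of f maps the velocity of c to the velocity of f \o c. *)
Definition isometric (E F : normedModType R) (X Y : Type)
    (A : charts E X) (S : set X) (G : bilinear_field A)
    (B : charts F Y) (S' : set Y) (G' : bilinear_field B) : Prop :=
  exists (f : X -> Y) (f' : Y -> X),
    [/\ forall u, S u -> S' (f u) /\ f' (f u) = u,
        forall v, S' v -> S (f' v) /\ f (f' v) = v,
        smooth_on A B S f,
        smooth_on B A S' f' &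
        forall c d : R^o -> X, curve_in A S c -> curve_in A S d -> c 0 = d 0 ->
          G' (f (c 0)) (velocity B (f \o c)) (velocity B (f \o d)) =
          G (c 0) (velocity A c) (velocity A d)].

End Isometry.

Record smooth_manifold (R : realType) (n : nat) (M : topologicalType)
    (A : charts 'rV[R]_n M) : Prop := {
  _ : hausdorff_space M;
  _ : @second_countable M;
  _ : forall p, points A p;
  _ : forall i, open (chart_dom A i);
  _ : forall i : chart_idx A, open (chart_img i);
  _ : forall i p, chart_dom A i p -> chart_inv A i (chart_map A i p) = p;
  _ : forall i p, chart_dom A i p -> {for p, continuous (chart_map A i)};
  _ : forall (i : chart_idx A) x, chart_img i x ->
        {for x, continuous (chart_inv A i)};
  _ : forall i j, smooth (chart_map A i @` (chart_dom A i `&` chart_dom A j))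
                         (transition i j) }.

Lemma derive_line (R : realType) (W : normedModType R) (z w : W) :
  'D_1 (fun t : R^o => z + (t : R) *: w) (0 : R^o) = w.
Proof.
apply: (@cvg_lim W (@norm_hausdorff R W)).
apply: cvg_near_cst.
near=> h.
have h0 : h != 0 by near: h; exact: nbhs_dnbhs_neq.
rewrite /= scale0r addr0 addr0 addrAC subrr add0r scalerA [h *: 1]mulr1 mulVf //.
by rewrite scale1r.
Unshelve. all: by end_near.
Qed.

Section Riemannian.
Context {R : realType} {n : nat} {M : topologicalType}.
Variable A : charts 'rV[R]_n M.
Local Notation E := 'rV[R]_n.
Local Notation TM := (M * fib A)%type.

Record riemannian (g : bilinear_field A) : Prop := {
  _ : forall p v w, is_tangent A p v -> is_tangent A p w -> g p v w = g p w v;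
  _ : forall p (a : R) v v' w,
        is_tangent A p v -> is_tangent A p v' -> is_tangent A p w ->
        g p (a *: v + v') w = a * g p v w + g p v' w;
  _ : forall p v, is_tangent A p v -> v <> 0 -> 0 < g p v v;
  _ : forall (i : chart_idx A) (a b : E),
        smooth (W := R^o) (chart_img i)
          (fun x => g (chart_inv A i x) (tvec i x a) (tvec i x b)) }.

(* A linear connection, given by its Christoffel symbols in each chart: for
   vector fields Y and tangent vectors a expressed in the chart i,
   nabla_a Y (x) = D_a Y (x) + Gamma i x a (Y x). *)
Definition christoffel : Type := chart_idx A -> E -> E -> E -> E.

Record linear_connection (Gamma : christoffel) : Prop := {
  _ : forall (i : chart_idx A) x (k : R) a a' b, chart_img i x ->
        Gamma i x (k *: a + a') b = k *: Gamma i x a b + Gamma i x a' b;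
  _ : forall (i : chart_idx A) x (k : R) a b b', chart_img i x ->
        Gamma i x a (k *: b + b') = k *: Gamma i x a b + Gamma i x a b';
  _ : forall (i : chart_idx A) a b,
        smooth (chart_img i) (fun x => Gamma i x a b);
  _ : forall (i j : chart_idx A) x a b,
        chart_img i x -> chart_dom A j (chart_inv A i x) ->
        let T := transition i j in
        'd T x (Gamma i x a b) =
        'D_a ('D_b T) x + Gamma j (T x) ('d T x a) ('d T x b) }.

Definition covariant (Gamma : christoffel) i (X Y : E -> E) (x : E) : E :=
  'D_(X x) Y x + Gamma i x (X x) (Y x).

Definition lie_bracket (X Y : E -> E) (x : E) : E :=
  'D_(X x) Y x - 'D_(Y x) X x.

Definition torsion_free (Gamma : christoffel) : Prop :=
  forall (i : chart_idx A) (X Y : E -> E) x,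
    smooth (chart_img i) X -> smooth (chart_img i) Y -> chart_img i x ->
    covariant Gamma i X Y x - covariant Gamma i Y X x = lie_bracket X Y x.

Definition metric_compatible (g : bilinear_field A) (Gamma : christoffel)
    : Prop :=
  forall (i : chart_idx A) (X Y Z : E -> E) x,
    smooth (chart_img i) X -> smooth (chart_img i) Y ->
    smooth (chart_img i) Z ->
    chart_img i x ->
    let gi y a b : R^o := g (chart_inv A i y) (tvec i y a) (tvec i y b) in
    'D_(X x) (fun y => gi y (Y y) (Z y)) x =
    gi x (covariant Gamma i X Y x) (Z x) + gi x (Y x) (covariant Gamma i X Z x).

Definition levi_civita (g : bilinear_field A) (Gamma : christoffel) : Prop :=
  [/\ linear_connection Gamma, torsion_free Gamma & metric_compatible g Gamma].

Definition dpi (u : TM) (xi : fib (tangent A)) : fib A :=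
  (tangent_map (A := tangent A) A fst (u, xi)).2.

Definition vertical (u : TM) : set (fib (tangent A)) :=
  [set xi | is_tangent (tangent A) u xi /\ dpi u xi = 0].

(* the image of w under the identification of the tangent space at pi u with
   V_u: the velocity of the curve u + t w of the fibre *)
Definition vertical_lift (u : TM) (w : fib A) : fib (tangent A) :=
  velocity (tangent A) (fun t : R^o => (u.1, u.2 + (t : R) *: w)).

Lemma vertical_liftE (u : TM) (w : fib A) i :
  is_tangent A u.1 u.2 -> chart_dom A i u.1 -> vertical_lift u w i = (0, w i).
Proof.
move=> tu du; rewrite /vertical_lift /velocity /= scale0r addr0.
case: asboolP => [_|[]]; last by split.
set c := (X in derive X).
suff -> : c = fun t : R^o =>
    ((chart_map A i u.1, u.2 i) : E * E) + (t : R) *: ((0, w i) : E * E).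
  exact: derive_line.
apply/funext => t; apply: injective_projections; rewrite /c /=.
  by rewrite scaler0 addr0.
by [].
Qed.

Lemma dpi_vertical_lift (u : TM) (w : fib A) :
  smooth_manifold A -> is_tangent A u.1 u.2 -> dpi u (vertical_lift u w) = 0.
Proof.
case=> _ _ _ _ _ chK _ _ sm tu; apply/funext => j; rewrite /dpi /tangent_map /=.
case: asboolP => // dj; case: pselect => // pu.
case: cid => i /= [di _]; rewrite vertical_liftE //.
set x := (_, _).
have dx : differentiable (transition i j) x.1.
  by have [+ _] := sm i j 1%N; apply; exists u.1.
have -> : chart_map A j \o fst \o
    (fun z : E * E => (chart_inv A i z.1, tvec i z.1 z.2)) =
    transition i j \o (fst : E * E -> E) by [].
rewrite diff_comp //; last first.
  by apply: linear_differentiable => ?; exact: cvg_fst.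
rewrite /= diff_lin /=; last by move=> ?; exact: cvg_fst.
exact: linear0.
Qed.

(* the velocities at u of the curves in TM, seen as vector fields along their
   projections to M, whose covariant derivative vanishes *)
Definition horizontal (Gamma : christoffel) (u : TM)
    : set (fib (tangent A)) :=
  [set xi | is_tangent (tangent A) u xi /\ forall i, chart_dom A i u.1 ->
     (xi i).2 + Gamma i (chart_map A i u.1) (xi i).1 (u.2 i) = 0].

(* The projection of T_u TM onto V_u along H_u, followed by the identification
   of V_u with the tangent space at pi u; see [connector_horizontal] and
   [connector_vertical_lift]. *)
Definition connector (Gamma : christoffel) (u : TM) (xi : fib (tangent A))
    : fib A := fun i =>
  if `[< chart_dom A i u.1 >]
  then (xi i).2 + Gamma i (chart_map A i u.1) (xi i).1 (u.2 i)
  else 0.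

Lemma connector_horizontal (Gamma : christoffel) (u : TM)
    (xi : fib (tangent A)) :
  is_tangent (tangent A) u xi ->
  connector Gamma u xi = 0 <-> horizontal Gamma u xi.
Proof.
move=> txi; split => [K0|[_ H]]; last first.
  by apply/funext => i; rewrite /connector; case: asboolP => // /H.
split => // i du; have := congr1 (@^~ i) K0.
by rewrite /connector asboolT.
Qed.

Lemma connector_vertical_lift (Gamma : christoffel) (u : TM) (w : fib A) :
  smooth_manifold A -> linear_connection Gamma ->
  is_tangent A u.1 u.2 -> is_tangent A u.1 w ->
  connector Gamma u (vertical_lift u w) = w.
Proof.
move=> hM [Gl _ _ _] tu [w0 _]; apply/funext => i; rewrite /connector.
case: asboolP => di; last by rewrite w0.
rewrite vertical_liftE //=.
have ci : chart_img i (chart_map A i u.1) by exists u.1.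
have := Gl i _ 1 0 0 (u.2 i) ci; rewrite scale1r addr0 scale1r => /eqP.
by rewrite -subr_eq subrr => /eqP <-; rewrite addr0.
Qed.

(* The metric g^{f1,f2}: [dpi] vanishes on V_u and [connector] on H_u, so this is
   the orthogonal direct sum of f1 pi^*g on H_u and f2 pi^*g on V_u. *)
Definition lift_metric (g : bilinear_field A) (Gamma : christoffel)
    (f1 f2 : M -> R) : bilinear_field (tangent A) := fun u xi eta =>
  f1 u.1 * g u.1 (dpi u xi) (dpi u eta) +
  f2 u.1 * g u.1 (connector Gamma u xi) (connector Gamma u eta).

Definition sasaki (g : bilinear_field A) (Gamma : christoffel) :=
  lift_metric g Gamma (fun=> 1) (fun=> 1).

Definition sphere_bundle (g : bilinear_field A) (r : M -> R) : set TM :=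
  [set u | points (tangent A) u /\ g u.1 u.2 u.2 = r u.1 ^+ 2].

End Riemannian.

(* Main.v *)
From HB Require Import structures.
Require Import Defs.
From mathcomp Require Import all_boot all_order all_algebra.
From mathcomp Require Import all_classical all_reals all_analysis.
From mathcomp Require Import ring.
Import Order.TTheory GRing.Theory Num.Theory.
Import numFieldNormedType.Exports.
Local Open Scope classical_set_scope.
Local Open Scope ring_scope.

(** The isometry is the obvious fibrewise rescaling
    f (p, v) = (p, v / r(p)^2), which maps vectors of length r to vectors of
    length 1/r; its inverse multiplies by r^2.  Both are smooth because r is.

    Let c be a curve in S_r M with c(0) = (p, v), let X be its projected
    velocity at p, and let K be the covariant derivative at 0 of c, seen as a
    vector field along its projection; X and K are the horizontal and the
    vertical part of the velocity of c.  The curve f o c has the same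
    projection, so the horizontal part X is unchanged.  By the Leibniz rule its
    vertical part is r^-2 K + X(r^-2) v = r^-2 (K - (2 X(r) / r) v).  On the
    other hand, g(c, c) = r^2 along c and the connection is metric, so that
    g(K, v) = r X(r).  Since g(v, v) = r^2, the vertical part of f o c is
      r^-2 (K - 2 (g(K, v) / g(v, v)) v),
    that is, r^-2 times the reflection of K in the hyperplane orthogonal to v
    ([connector_sphere_scale]).  Reflections preserve g
    ([reflection_isometry]), and the weight r^4 of the vertical part in the
    target metric cancels the factor (r^-2)^2.

    Most of the work lies in the charts.  The components of a curve of the
    tangent bundle in two charts are related by the differential of the
    transition map, hence the fibre components of its velocity by a second
    derivative ([change_of_chart]), which the transformation law of the
    Christoffel symbols cancels: K is a tangent vector at p
    ([connector_tangent]).  Only then can the bilinearity of g be applied to it.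
    Metric compatibility is given for vector fields, and [is_derive_apply]
    carries it over to vectors varying along a curve
    ([metric_derivative]). *)

Set Implicit Arguments.
Unset Strict Implicit.
Unset Printing Implicit Defensive.

(** * Differential calculus along curves *)

Section Calculus.
Context {R : realType}.
Implicit Types (V W : normedModType R) (t : R^o).

Lemma scale_is_bilinear W :
  bilinear_for
    (GRing.Scale.Law.clone _ _ *:%R _) (GRing.Scale.Law.clone _ _ *:%R _)
    (@GRing.scale R W).
Proof.
split=> [u|q] a x y /=; first by rewrite scalerDl scalerA.
by rewrite scalerDr scalerA mulrC -scalerA.
Qed.
HB.instance Definition _ W := bilinear_isBilinear.Build R R W W _ _
  (@GRing.scale R W) (@scale_is_bilinear W).

Lemma is_diff_scale V W (q dq : V -> R^o) (f df : V -> W) x :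
  is_diff x q dq -> is_diff x f df ->
  is_diff x (fun y => (q y : R) *: f y)
    (fun v => (q x : R) *: df v + (dq v : R) *: f x).
Proof.
move=> [dqx <-] [dfx <-].
have sc : continuous (fun p : R * W => p.1 *: p.2).
  by move=> p; exact: scale_continuous.
have dp := differentiable_pair dqx dfx.
have ds := @differentiable_bilin _ _ _ _ (@GRing.scale R W) (q x, f x) sc.
apply: DiffDef; first exact: (differentiable_comp dp ds).
rewrite (diff_comp dp ds) (@diff_bilin _ _ _ _ (@GRing.scale R W) _ sc).
by rewrite diff_pair.
Qed.

Lemma is_derive_comp V W (a : R^o -> V) (F : V -> W) t a' :
  is_derive t 1 a a' -> differentiable F (a t) ->
  is_derive t 1 (F \o a) ('d F (a t) a').
Proof.
move=> [/derivable1_diffP da <-] dF; rewrite deriveE //.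
have dFa := differentiable_comp da dF.
by apply: DeriveDef; [exact/derivable1_diffP|rewrite deriveE // diff_comp].
Qed.

Lemma is_derive_scale W (q : R^o -> R^o) (f : R^o -> W) t q' f' :
  is_derive t 1 q q' -> is_derive t 1 f f' ->
  is_derive t 1 (fun s => (q s : R) *: f s)
    ((q t : R) *: f' + (q' : R) *: f t).
Proof.
move=> [/derivable1_diffP dq <-] [/derivable1_diffP df <-].
have [d e] := is_diff_scale (differentiableP dq) (differentiableP df).
by apply: DeriveDef; [exact/derivable1_diffP|rewrite !deriveE // e].
Qed.

Lemma is_derive_pair V W (a : R^o -> V) (b : R^o -> W) t a' b' :
  is_derive t 1 a a' -> is_derive t 1 b b' ->
  is_derive t 1 (fun s => (a s, b s)) (a', b').
Proof.
move=> [/derivable1_diffP da <-] [/derivable1_diffP db <-].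
have dab := differentiable_pair da db.
apply: DeriveDef; first exact/derivable1_diffP.
by rewrite !deriveE // diff_pair.
Qed.

(** The Leibniz rule for a family of linear maps [Phi t] applied to a vector
    [b t], with the derivative of [Phi] known only on constant vectors.
    Expanding [b t] in coordinates gives a formula in the values of [D] on the
    basis; the same formula for the constant curve [b 0] identifies the
    combination of these values that occurs with [D (b 0)]. *)
Lemma is_derive_apply n W (Phi : R^o -> 'rV[R]_n -> W) (D : 'rV[R]_n -> W)
    (b : R^o -> 'rV[R]_n) b' :
  (\forall t \near (0 : R^o), forall k u v,
     Phi t (k *: u + v) = k *: Phi t u + Phi t v) ->
  (forall u, is_derive (0 : R^o) 1 (Phi^~ u) (D u)) ->
  is_derive (0 : R^o) 1 b b' ->
  is_derive (0 : R^o) 1 (fun t => Phi t (b t)) (Phi 0 b' + D (b 0)).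
Proof.
move=> lin dPhi db.
have expand (t : R^o) : (forall k u v,
     Phi t (k *: u + v) = k *: Phi t u + Phi t v) ->
   forall u, Phi t u = \sum_k u 0 k *: Phi t (delta_mx 0 k).
  move=> l u.
  pose P : {linear 'rV[R]_n -> W} := HB.pack (Phi t)
    (GRing.isLinear.Build _ _ _ _ (Phi t) l).
  rewrite -[Phi t u]/(P u) {1}(row_sum_delta u) linear_sum.
  by apply: eq_bigr => k _; rewrite linearZ.
have sum_derive (c : R^o -> 'rV[R]_n) c' : is_derive (0 : R^o) 1 c c' ->
    is_derive (0 : R^o) 1 (fun t => Phi t (c t))
      (\sum_k (c 0 0 k *: D (delta_mx 0 k) + c' 0 k *: Phi 0 (delta_mx 0 k))).
  move=> dc; apply: near_eq_is_derive; last first.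
    apply: (is_derive_sum (h := fun k (t : R^o) =>
      c t 0 k *: Phi t (delta_mx 0 k))) => k.
    have dck : is_derive (0 : R^o) 1 (fun t => c t 0 k : R^o) (c' 0 k).
      case: dc => dc <-; rewrite derive_mx // mxE.
      by apply: DeriveDef => //; move/derivable_mxP : dc; exact.
    exact: is_derive_scale.
  near=> t; rewrite fct_sumE expand //; near: t; exact: lin.
apply: is_derive_eq (sum_derive _ _ db) _.
rewrite big_split /= addrC -expand; last exact: nbhs_singleton lin.
have [_ <-] := dPhi (b 0).
have [_ ->] := sum_derive (cst (b 0)) 0 (is_derive_cst _ _ _).
congr (_ + _); apply: eq_bigr => k _; by rewrite mxE scale0r addr0.
Unshelve. all: by end_near.
Qed.
End Calculus.

(** * Closure properties of [Ck] maps on an open set *)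

Section Ck.
Context {R : realType}.
Implicit Types V W : normedModType R.

(** The difference of two maps that agree near [x] is differentiable at [x]
    with zero differential. *)
Lemma near_eq_differentiable V W (f g : V -> W) x :
  (\forall y \near x, f y = g y) -> differentiable f x -> differentiable g x.
Proof.
move=> fg df.
have gfx := nbhs_singleton fg.
have -> : g = f + (g - f) by rewrite addrC subrK.
apply: differentiableD => //.
pose Z : {linear V -> W} := \0.
have Zc : continuous Z by exact: cst_continuous.
have e : (g - f) \o shift x = cst ((g - f) x) + Z +o_ 0 id.
  apply/eqaddoP => _/posnumP[eps].
  have fg0 : \forall y \near (0 : V), f (y + x) = g (y + x).
    by have := fg; rewrite (near_shift 0) subr0.
  near=> y; have e : f (y + x) = g (y + x) by near: y.
  by rewrite !fctE /= e -gfx !subrr addr0 subr0 normr0 mulr_ge0.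
by apply/diff_locallyP; rewrite (diff_unique Zc e).
Unshelve. all: by end_near.
Qed.

(** The rules of differentiation hold only at the points of [U], whereas [Ck]
    speaks of the derivatives as functions on the whole space; this lemma is
    what allows the formulas for the derivatives to be used below. *)
Lemma Ck_ext k V W (U : set V) (f g : V -> W) :
  open U -> (forall x, U x -> f x = g x) -> Ck k U f -> Ck k U g.
Proof.
move=> oU; elim: k f g => [|k IH] f g fg.
  move=> fc x Ux; have := fc x Ux.
  rewrite /prop_for /continuous_at (fg x Ux); apply: cvg_trans; apply: near_eq_cvg.
  by apply: filterS (open_nbhs_nbhs (conj oU Ux)) => y /fg.
have nfg x : U x -> \forall y \near x, f y = g y.
  by move=> Ux; apply: filterS (open_nbhs_nbhs (conj oU Ux)) => y /fg.
move=> [df Df]; split=> [x Ux|v].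
  exact: near_eq_differentiable (nfg _ Ux) (df x Ux).
by apply: IH (Df v) => x Ux; apply: near_eq_derive; exact: nfg.
Qed.

Lemma CkW k V W (U : set V) (f : V -> W) : Ck k.+1 U f -> Ck k U f.
Proof.
elim: k f => [f [df _] x Ux|k IH f [df Df]].
  exact/differentiable_continuous/df.
by split=> // v; apply: IH; exact: Df.
Qed.

Lemma Ck_cst k V W (U : set V) (w : W) : Ck k U (cst w : V -> W).
Proof.
elim: k w => [|k IH] w; first by move=> x _; exact: cst_continuous.
split=> [x _|v]; first exact: differentiable_cst.
by rewrite (_ : 'D_v (cst w) = cst 0) //; apply/funext => x; rewrite derive_cst.
Qed.

Lemma Ck_linear k V W (U : set V) (L : {linear V -> W}) :
  continuous L -> Ck k U L.
Proof.
move=> Lc; case: k => [|k]; first by move=> x _; exact: Lc.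
split=> [x _|v]; first exact: linear_differentiable.
rewrite (_ : 'D_v L = cst (L v)); first exact: Ck_cst.
by apply/funext => x; rewrite deriveE ?diff_lin //; exact: linear_differentiable.
Qed.

Lemma CkD k V W (U : set V) (f g : V -> W) :
  open U -> Ck k U f -> Ck k U g -> Ck k U (fun x => f x + g x).
Proof.
move=> oU; elim: k f g => [|k IH] f g.
  by move=> fc gc x Ux; apply: continuousD; [exact: fc|exact: gc].
move=> [df Df] [dg Dg]; split=> [x Ux|v].
  by apply: differentiableD; [exact: df|exact: dg].
apply: Ck_ext (IH _ _ (Df v) (Dg v)) => // x Ux.
by rewrite -deriveD //; apply: diff_derivable; [exact: df|exact: dg].
Qed.

Lemma Ck_scale k V W (U : set V) (q : V -> R^o) (f : V -> W) :
  open U -> Ck k U q -> Ck k U f -> Ck k U (fun x => (q x : R) *: f x).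
Proof.
move=> oU; elim: k q f => [|k IH] q f.
  by move=> qc fc x Ux; apply: continuousZ; [exact: qc|exact: fc].
move=> Cq Cf; have [dq Dq] := Cq; have [df Df] := Cf.
have dqf x : U x -> is_diff x (fun x => (q x : R) *: f x)
    (fun v => (q x : R) *: 'd f x v + ('d q x v : R) *: f x).
  move=> Ux; apply: is_diff_scale; apply: differentiableP.
    exact: dq.
  exact: df.
split=> [x /dqf[] //|v].
apply: Ck_ext (CkD oU (IH _ _ (CkW Cq) (Df v)) (IH _ _ (Dq v) (CkW Cf))) => //.
move=> x Ux; have [d e] := dqf x Ux.
by rewrite (deriveE v d) e (deriveE v (df x Ux)) (deriveE v (dq x Ux)).
Qed.

Lemma Ck_inv k V (U : set V) (q : V -> R^o) :
  open U -> (forall x, U x -> q x != 0) -> Ck k U q ->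
  Ck k U (fun x => (q x)^-1 : R^o).
Proof.
move=> oU q0; elim: k => [|k IH] Cq.
  by move=> x Ux; apply: continuousV; [exact: q0|exact: Cq].
have [dq Dq] := Cq.
split=> [x Ux|v].
  apply: differentiable_comp; first exact: dq.
  by apply: differentiable_Rinv; exact: q0.
have Ci := IH (CkW Cq).
(* The derivative of [1 / q] is [- (1 / q) (1 / q) q'], where the induction
   hypothesis applies to the factors [1 / q]. *)
apply: Ck_ext (Ck_scale oU (Ck_cst k U (-1 : R^o))
  (Ck_scale oU Ci (Ck_scale oU Ci (Dq v)))) => // x Ux /=.
rewrite (deriveV (q0 x Ux)); last exact: diff_derivable (dq x Ux).
rewrite scaleN1r scaleNr; congr (- _).
by rewrite scalerA -invfM.
Qed.

Lemma Ck_comp_linear k V V' W (U : set V) (L : {linear V' -> V}) (f : V -> W) :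
  continuous L -> open U -> Ck k U f -> Ck k (L @^-1` U) (f \o L).
Proof.
move=> Lc oU; elim: k f => [|k IH] f.
  move=> fc x Ux; apply: continuous_comp; [exact: Lc|exact: fc].
move=> [df Df]; split=> [x Ux|v].
  apply: differentiable_comp; [exact: linear_differentiable|exact: df].
apply: Ck_ext (IH _ (Df (L v))).
  by apply: open_comp => // x _; exact: Lc.
move=> x Ux; have dL := linear_differentiable x Lc.
have dfx := df _ Ux; have dc := differentiable_comp dL dfx.
by rewrite (deriveE v dc) (diff_comp dL dfx) /= diff_lin // -deriveE.
Qed.

(** The rescaling of the fibres in a chart of the tangent bundle: it is the sum
    of a linear map and of the product of a scalar map with a linear map. *)
Lemma Ck_fst_scale k V W (U : set V) (q : V -> R^o) :
  open U -> Ck k U q ->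
  Ck k (fst @^-1` U) (fun z : V * W => (z.1, (q z.1 : R) *: z.2)).
Proof.
move=> oU Cq.
have fstc : continuous (fst : V * W -> V) by move=> ?; exact: cvg_fst.
have oU' : open ((fst : V * W -> V) @^-1` U).
  by apply: open_comp => // z _; exact: fstc.
pose L1 (z : V * W) : V * W := (z.1, 0).
pose L2 (z : V * W) : V * W := (0, z.2).
have L1l : linear L1.
  by move=> c y z; rewrite /L1 -[RHS]/(_, _) /= scaler0 addr0.
have L2l : linear L2.
  by move=> c y z; rewrite /L2 -[RHS]/(_, _) /= scaler0 addr0.
pose L1L : {linear (V * W)%type -> (V * W)%type} :=
  HB.pack L1 (GRing.isLinear.Build _ _ _ _ L1 L1l).
pose L2L : {linear (V * W)%type -> (V * W)%type} :=
  HB.pack L2 (GRing.isLinear.Build _ _ _ _ L2 L2l).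
have L1c : continuous L1L.
  by move=> z; apply: cvg_pair; [exact: cvg_fst|exact: cvg_cst].
have L2c : continuous L2L.
  by move=> z; apply: cvg_pair; [exact: cvg_cst|exact: cvg_snd].
have Cqf := @Ck_comp_linear k _ _ _ U (fst : {linear (V * W)%type -> V}) q fstc oU Cq.
apply: Ck_ext (CkD oU' (Ck_linear k _ L1c)
  (Ck_scale oU' Cqf (Ck_linear k _ L2c))) => // z _.
by rewrite /= /L1 /L2; apply/pair_equal_spec; split=> /=;
  rewrite ?scaler0 ?addr0 ?add0r.
Qed.

End Ck.

(** * Charts, transition maps and tangent vectors *)

Section Manifold.
Context {R : realType} {n : nat} {M : topologicalType}.
Context {A : charts 'rV[R]_n M} (hM : smooth_manifold A).
Local Notation E := 'rV[R]_n.
Implicit Types (i j k : chart_idx A) (x a b : E) (p : M) (v w : fib A).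

Lemma chart_invK i p : chart_dom A i p -> chart_inv A i (chart_map A i p) = p.
Proof. by case: hM => _ _ _ _ _ + _ _ _; apply. Qed.

Lemma chart_imgP i x : chart_img i x ->
  chart_dom A i (chart_inv A i x) /\ chart_map A i (chart_inv A i x) = x.
Proof. by case=> p dp <-; rewrite chart_invK. Qed.

Lemma chart_img_map i p : chart_dom A i p -> chart_img i (chart_map A i p).
Proof. by exists p. Qed.

(** The domain of the transition map from [i] to [j] is open. *)
Lemma near_overlap i j x : chart_img i x -> chart_dom A j (chart_inv A i x) ->
  \forall y \near x, chart_img i y /\ chart_dom A j (chart_inv A i y).
Proof.
case: hM => _ _ _ od oi _ _ ic _ ix dj; near=> y; split.
  by near: y; exact: open_nbhs_nbhs.
near: y; apply: (ic i x ix); exact: open_nbhs_nbhs.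
Unshelve. all: by end_near.
Qed.

Section Transition.
Variables (i j : chart_idx A) (x : E).
Hypotheses (ix : chart_img i x) (jx : chart_dom A j (chart_inv A i x)).

Let smooth_transition l :
  Ck l (chart_map A i @` (chart_dom A i `&` chart_dom A j)) (transition i j).
Proof. by case: hM => _ _ _ _ _ _ _ _ /(_ i j); apply. Qed.

Let overlap : (chart_map A i @` (chart_dom A i `&` chart_dom A j)) x.
Proof. by have [di e] := chart_imgP ix; exists (chart_inv A i x). Qed.

Lemma transition_differentiable : differentiable (transition i j) x.
Proof. by have [+ _] := smooth_transition 1; apply. Qed.

Lemma derive_transition_differentiable b :
  differentiable ('D_b (transition i j)) x.
Proof. by have [_ /(_ b) [+ _]] := smooth_transition 2; apply. Qed.

Lemma chart_img_transition : chart_img j (transition i j x).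
Proof. by exists (chart_inv A i x). Qed.

Lemma chart_inv_transition :
  chart_inv A j (transition i j x) = chart_inv A i x.
Proof. by rewrite chart_invK. Qed.

End Transition.

(** The chain rule for the cocycle identity between transition maps, which
    holds near [x] only. *)
Lemma diff_transition_comp i j k x a : chart_img i x ->
  chart_dom A j (chart_inv A i x) -> chart_dom A k (chart_inv A i x) ->
  'd (transition j k) (transition i j x) ('d (transition i j) x a) =
  'd (transition i k) x a.
Proof.
move=> ix jx kx; have dij := transition_differentiable ix jx.
have dik := transition_differentiable ix kx.
have djk : differentiable (transition j k) (transition i j x).
  apply: transition_differentiable; first exact: chart_img_transition.
  by rewrite chart_inv_transition.
have dc := differentiable_comp dij djk.
have near_comp : \forall y \near x,
    transition i k y = (transition j k \o transition i j) y.
  near=> y; have [iy jy] : chart_img i y /\ chart_dom A j (chart_inv A i y).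
    by near: y; exact: near_overlap.
  by rewrite /transition /= chart_invK.
have chain : 'd (transition j k) (transition i j x) ('d (transition i j) x a)
    = 'D_a (transition j k \o transition i j) x.
  apply/esym/(etrans (deriveE a dc)).
  exact: (congr1 (@^~ a) (diff_comp dij djk)).
apply: etrans chain (etrans _ (deriveE a dik)).
exact/esym/near_eq_derive.
Unshelve. all: by end_near.
Qed.

Lemma diff_transition_id i x a : chart_img i x -> 'd (transition i i) x a = a.
Proof.
move=> ix; have [di e] := chart_imgP ix.
rewrite -(deriveE a (transition_differentiable ix di)).
rewrite -[RHS](derive_id x a); apply: near_eq_derive; near=> y.
have [iy _] : chart_img i y /\ chart_dom A i (chart_inv A i y).
  by near: y; exact: near_overlap.
by have [] := chart_imgP iy.
Unshelve. all: by end_near.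
Qed.

Lemma tvec_tangent i x a : chart_img i x ->
  is_tangent A (chart_inv A i x) (tvec i x a).
Proof.
move=> ix; split=> [j nj|j k dj dk]; rewrite /tvec; first by rewrite asboolF.
by rewrite !asboolT //; apply/esym; exact: diff_transition_comp.
Qed.

Lemma tvec_self i x a : chart_img i x -> tvec i x a i = a.
Proof.
move=> ix; have [di _] := chart_imgP ix.
by rewrite /tvec asboolT //; exact: diff_transition_id.
Qed.

Lemma tangent_tvec i p v : is_tangent A p v -> chart_dom A i p ->
  v = tvec i (chart_map A i p) (v i).
Proof.
move=> [v0 vc] di; apply/funext => j; rewrite /tvec chart_invK //.
by case: asboolP => [dj|/v0 //]; exact: vc.
Qed.

Lemma fibPE (k : R) v w i : (k *: v + w) i = k *: v i + w i.
Proof. by []. Qed.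

Lemma fibZE (k : R) v i : (k *: v) i = k *: v i.
Proof. by []. Qed.

Lemma is_tangentP p (k : R) v w :
  is_tangent A p v -> is_tangent A p w -> is_tangent A p (k *: v + w).
Proof.
move=> [v0 vc] [w0 wc]; split=> [i ni|i j di dj].
  by rewrite fibPE v0 // w0 // scaler0 addr0.
rewrite !fibPE linearP; congr (_ *: _ + _); [exact: vc|exact: wc].
Qed.

Lemma is_tangent0 p : is_tangent A p 0.
Proof. by split=> // i j _ _; rewrite linear0. Qed.

Lemma is_tangentZ p (k : R) v : is_tangent A p v -> is_tangent A p (k *: v).
Proof.
by move=> tv; rewrite -[_ *: _]addr0; apply: is_tangentP => //; exact: is_tangent0.
Qed.

Lemma tvecP i x (k : R) a b : chart_img i x ->
  tvec i x (k *: a + b) = k *: tvec i x a + tvec i x b.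
Proof.
move=> ix; apply/funext => j.
rewrite fibPE /tvec.
by case: asboolP => _; [rewrite linearP|rewrite scaler0 addr0].
Qed.

End Manifold.

(** * Curves in the tangent bundle *)

Section Curves.
Context {R : realType} {n : nat} {M : topologicalType}.
Context {A : charts 'rV[R]_n M} (hM : smooth_manifold A).
Local Notation E := 'rV[R]_n.
Implicit Types (i j : chart_idx A) (c : R^o -> M * fib A).

Definition base_coord i c : R^o -> E := fun t => chart_map A i (c t).1.

Definition fibre_coord i c : R^o -> E := fun t => (c t).2 i.

(** Being tangent is required for nearby [t] and not only at 0, as the
    components of the curve in the other charts are determined by those in
    [i] only where it is. *)
Definition derivable_in_chart i c : Prop :=
  [/\ \forall t \near (0 : R^o),
        chart_dom A i (c t).1 /\ is_tangent A (c t).1 (c t).2,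
      derivable (base_coord i c) 0 1 & derivable (fibre_coord i c) 0 1].

Definition derivable_curve c : Prop := exists i, derivable_in_chart i c.

(** With [T] the transition map, the base components are related by [T] and the
    fibre components by the differential of [T] along the base curve; the
    Leibniz rule for the latter yields the second derivative of [T]. *)
Lemma change_of_chart i j c :
  derivable_in_chart i c -> chart_dom A j (c 0).1 ->
  let T := transition i j in
  let x := base_coord i c 0 in
  let x' := 'D_1 (base_coord i c) 0 in
  [/\ \forall t \near (0 : R^o), chart_dom A j (c t).1,
      is_derive (0 : R^o) 1 (base_coord j c) ('d T x x') &
      is_derive (0 : R^o) 1 (fibre_coord j c)
        ('d T x ('D_1 (fibre_coord i c) 0) +
         'D_x' ('D_(fibre_coord i c 0) T) x)].
Proof.
move=> [nc da db] dj T x x'.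
have [di tc] := nbhs_singleton nc.
have ix : chart_img i x by exact: chart_img_map.
have jx : chart_dom A j (chart_inv A i x) by rewrite chart_invK.
have na : \forall t \near (0 : R^o), chart_img i (base_coord i c t) /\
    chart_dom A j (chart_inv A i (base_coord i c t)).
  have /differentiable_continuous ca := (derivable1_diffP _ _).1 da.
  exact: (ca _ (near_overlap hM ix jx)).
have nj : \forall t \near (0 : R^o), chart_dom A j (c t).1.
  near=> t; have [dit _] : chart_dom A i (c t).1 /\ is_tangent A (c t).1 (c t).2.
    by near: t.
  by rewrite -(chart_invK hM dit); near: t; apply: filterS na => t [].
split; first exact: nj.
  apply: near_eq_is_derive (is_derive_comp (derivableP da) _).
    near=> t; have [dit _] :
        chart_dom A i (c t).1 /\ is_tangent A (c t).1 (c t).2 by near: t.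
    by rewrite /= /T /transition /= chart_invK.
  exact: transition_differentiable.
apply: (near_eq_is_derive (f := fun t => 'd T (base_coord i c t) (fibre_coord i c t))).
  near=> t; have [dit [_ tt]] :
      chart_dom A i (c t).1 /\ is_tangent A (c t).1 (c t).2 by near: t.
  by apply/esym/tt => //; near: t.
apply: (is_derive_apply (Phi := fun t b => 'd T (base_coord i c t) b)
  (D := fun b => 'D_x' ('D_b T) x)) (derivableP db).
  by near=> t => k u v; rewrite linearP.
move=> u; have dDu := derive_transition_differentiable hM ix jx u.
apply: (near_eq_is_derive (f := 'D_u T \o base_coord i c)); last first.
  rewrite (deriveE x' dDu); exact: is_derive_comp (derivableP da) dDu.
near=> t; have [iat jat] : chart_img i (base_coord i c t) /\
    chart_dom A j (chart_inv A i (base_coord i c t)) by near: t.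
exact: deriveE (transition_differentiable hM iat jat).
Unshelve. all: by end_near.
Qed.

Lemma derivable_curve_in j c :
  derivable_curve c -> chart_dom A j (c 0).1 -> derivable_in_chart j c.
Proof.
move=> [i ci] dj; have [nj [da _] [db _]] := change_of_chart ci dj.
split; [|exact: da|exact: db].
have [nc _ _] := ci; near=> t; split; first by near: t.
by near: t; apply: filterS nc => t [].
Unshelve. all: by end_near.
Qed.

Lemma velocity_tangentE i c : derivable_in_chart i c ->
  velocity (tangent A) c i = ('D_1 (base_coord i c) 0, 'D_1 (fibre_coord i c) 0).
Proof.
move=> [nc da db]; have dc := nbhs_singleton nc.
rewrite /velocity asboolT //.
by have [] := is_derive_pair (derivableP da) (derivableP db).
Qed.

(** The differential of the projection is computed in an arbitrarily chosen
    chart; the chain rule makes its value on a velocity independent of that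
    choice. *)
Lemma dpi_velocity c : derivable_curve c ->
  dpi (c 0) (velocity (tangent A) c) = velocity A (fst \o c).
Proof.
move=> hc; apply/funext => j; rewrite /dpi /tangent_map /velocity /=.
case: asboolP => // dj.
have [_ tc] : chart_dom A j (c 0).1 /\ is_tangent A (c 0).1 (c 0).2.
  by have [nc _ _] := derivable_curve_in hc dj; exact: nbhs_singleton nc.
case: pselect => [pc|[]]; last by exists j.
case: cid => i [di _] /=; have hi := derivable_curve_in hc di.
rewrite -/(velocity (tangent A) c i) velocity_tangentE //.
have [_ [_ ->] _] := change_of_chart hi dj.
set x := (_, _).
have dT : differentiable (transition i j) x.1.
  by apply: transition_differentiable; [|exact: chart_img_map|rewrite chart_invK].
have dfst : differentiable (fst : E * E -> E) x.
  by apply: linear_differentiable => ?; exact: cvg_fst.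
apply: etrans (congr1 (@^~ _) (diff_comp dfst dT)) _ => /=.
by rewrite diff_lin // => ?; exact: cvg_fst.
Qed.

Lemma smooth_curve_derivable c (e : R) : 0 < e ->
  smooth_on (real_line R) (tangent A) (ball (0 : R^o) e) c -> derivable_curve c.
Proof.
move=> e0 /(_ 0 (ballxx _ e0)) [l [i [U [h [[_ oU U0 _] [sh ch]]]]]].
have near_h : \forall t \near (0 : R^o), [/\ chart_dom A i (c t).1,
    is_tangent A (c t).1 (c t).2 &
    (base_coord i c t, fibre_coord i c t) = h t].
  near=> t; have [] // := ch t.
  - by near: t; exact: open_nbhs_nbhs.
  - by near: t; exact: nbhsx_ballx.
  by case.
have dh : differentiable h 0 by have [+ _] := sh 1%N; apply.
exists i; split; first by apply: filterS near_h => t [].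
- apply: (@near_eq_derivable _ _ _ (fst \o h)).
    by apply: filterS near_h => t [_ _ /= <-].
  apply/derivable1_diffP/differentiable_comp => //.
  by apply: linear_differentiable => ?; exact: cvg_fst.
apply: (@near_eq_derivable _ _ _ (snd \o h)).
  by apply: filterS near_h => t [_ _ /= <-].
apply/derivable1_diffP/differentiable_comp => //.
by apply: linear_differentiable => ?; exact: cvg_snd.
Unshelve. all: by end_near.
Qed.

(** The connector of a velocity is the covariant derivative of the curve. *)
Lemma connectorE (Gamma : christoffel A) i c : derivable_in_chart i c ->
  connector Gamma (c 0) (velocity (tangent A) c) i =
  'D_1 (fibre_coord i c) 0 +
  Gamma i (base_coord i c 0) ('D_1 (base_coord i c) 0) (fibre_coord i c 0).
Proof.
move=> ci; have [nc _ _] := ci; have [di _] := nbhs_singleton nc.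
by rewrite /connector asboolT // velocity_tangentE.
Qed.

(** The second derivative of the transition map in the velocity of the curve
    ([change_of_chart]) and the one in the transformation law of the
    Christoffel symbols cancel. *)
Lemma connector_tangent (Gamma : christoffel A) c :
  linear_connection Gamma -> derivable_curve c ->
  is_tangent A (c 0).1 (connector Gamma (c 0) (velocity (tangent A) c)).
Proof.
move=> [_ _ _ GT] hc; split=> [i ni|i j di dj].
  by rewrite /connector asboolF.
have ci := derivable_curve_in hc di; have cj := derivable_curve_in hc dj.
have [nc _ _] := ci; have [_ [_ /(_ i j di dj) ej]] := nbhs_singleton nc.
rewrite !connectorE //.
have [_ [_ ->] [_ ->]] := change_of_chart ci dj.
have ix : chart_img i (base_coord i c 0) by exact: chart_img_map.
have jx : chart_dom A j (chart_inv A i (base_coord i c 0)).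
  by rewrite chart_invK.
rewrite linearD (GT i j _ _ _ ix jx) addrA; congr (_ + _).
have -> : base_coord j c 0 = transition i j (base_coord i c 0).
  by rewrite /transition /= chart_invK.
by rewrite /fibre_coord ej.
Qed.

(** The Leibniz rule for the covariant derivative of a scalar multiple of a
    vector field along a curve. *)
Lemma connector_scale (Gamma : christoffel A) c (q : R^o -> R^o) q' :
  linear_connection Gamma -> derivable_curve c -> is_derive (0 : R^o) 1 q q' ->
  let d := fun t : R^o => ((c t).1, (q t : R) *: (c t).2) in
  derivable_curve d /\
  connector Gamma (d 0) (velocity (tangent A) d) =
  (q 0 : R) *: connector Gamma (c 0) (velocity (tangent A) c) +
  (q' : R) *: (c 0).2.
Proof.
move=> [Gl Gr _ _] hc dq d.
have dd i : chart_dom A i (c 0).1 -> derivable_in_chart i d /\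
    'D_1 (fibre_coord i d) 0 = (q 0 : R) *: 'D_1 (fibre_coord i c) 0 +
      (q' : R) *: fibre_coord i c 0.
  move=> di; have [nc da db] := derivable_curve_in hc di.
  have [db' e] := is_derive_scale dq (derivableP db).
  split; last exact: e.
  split; [|exact: da|exact: db']; near=> t.
  have [dit tt] : chart_dom A i (c t).1 /\ is_tangent A (c t).1 (c t).2.
    by near: t.
  by split=> //; exact: is_tangentZ.
have [i0 [nc0 _ _]] := hc; have [di0 [c0 _]] := nbhs_singleton nc0.
split; first by exists i0; have [] := dd _ di0.
apply/funext => i; rewrite fibPE fibZE.
have [di|ni] := pselect (chart_dom A i (c 0).1); last first.
  by rewrite /connector !asboolF // c0 // !scaler0 addr0.
have [hd e] := dd _ di; have hi := derivable_curve_in hc di.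
rewrite !connectorE // e.
have -> : base_coord i d = base_coord i c by [].
have ix : chart_img i (base_coord i c 0) by exact: chart_img_map.
have Gs (s : R) a b : Gamma i (base_coord i c 0) a (s *: b) =
    s *: Gamma i (base_coord i c 0) a b.
  have G0 : Gamma i (base_coord i c 0) a 0 = 0.
    have := Gr i _ (-1) a 0 0 ix; rewrite scaler0 addr0 scaleN1r.
    by rewrite addNr.
  by have := Gr i _ s a b 0 ix; rewrite G0 !addr0.
by rewrite {3}/fibre_coord /d /= Gs scalerDr addrAC.
Unshelve. all: by end_near.
Qed.

End Curves.

(** * Scalar functions and rescaling of the fibres *)

Section FibreScale.
Context {R : realType} {n : nat} {M : topologicalType}.
Context {A : charts 'rV[R]_n M} (hM : smooth_manifold A).
Local Notation E := 'rV[R]_n.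
Implicit Types (p : M) (c : R^o -> M * fib A).

Lemma smooth_on_derivable (s : M -> R) c :
  smooth_on A (real_line R) [set: M] s -> derivable_curve c ->
  derivable (fun t : R^o => s (c t).1 : R^o) 0 1.
Proof.
move=> /(_ (c 0).1 I) [i [l [U [h [[di oU U0 _] [sh sE]]]]]] hc.
have [nc da _] := derivable_curve_in hM hc di.
have dh : differentiable h (base_coord i c 0) by have [+ _] := sh 1%N; apply.
have [dhc _] := is_derive_comp (derivableP da) dh.
apply: near_eq_derivable dhc.
have /differentiable_continuous ca := (derivable1_diffP _ _).1 da.
near=> t; have [dit _] : chart_dom A i (c t).1 /\ is_tangent A (c t).1 (c t).2.
  by near: t.
have Ut : U (base_coord i c t).
  near: t; apply: ca; exact: open_nbhs_nbhs.
have [_] := sE _ Ut I.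
by rewrite /= /base_coord chart_invK.
Unshelve. all: by end_near.
Qed.

Lemma smooth_on_sqr (s : M -> R) : smooth_on A (real_line R) [set: M] s ->
  smooth_on A (real_line R) [set: M] (fun p => s p ^+ 2).
Proof.
move=> hs p _; have [i [l [U [h [Ui [sh sE]]]]]] := hs p I.
exists i, l, U, (fun x => (h x : R) *: h x); split=> //; split.
  by case: Ui => _ oU _ _ k; apply: Ck_scale => //; exact: sh.
by move=> x Ux _; have [_ <-] := sE x Ux I; split.
Qed.

Lemma smooth_on_inv (s : M -> R) : (forall p, s p != 0) ->
  smooth_on A (real_line R) [set: M] s ->
  smooth_on A (real_line R) [set: M] (fun p => (s p)^-1).
Proof.
move=> s0 hs p _; have [i [l [U [h [Ui [sh sE]]]]]] := hs p I.
exists i, l, U, (fun x => (h x)^-1 : R^o); split=> //; split.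
  case: Ui => _ oU _ _ k; apply: Ck_inv => //.
  by move=> x Ux; have [_ <-] := sE x Ux I; exact: s0.
by move=> x Ux _; have [_ <-] := sE x Ux I; split.
Qed.

Definition fibre_scale (s : M -> R) (z : M * fib A) : M * fib A :=
  (z.1, s z.1 *: z.2).

Lemma smooth_fibre_scale (s : M -> R) (S : set (M * fib A)) :
  smooth_on A (real_line R) [set: M] s -> S `<=` points (tangent A) ->
  smooth_on (tangent A) (tangent A) S (fibre_scale s).
Proof.
move=> hs hS z Sz; have [i [l [U [h [[di oU Uz Ui] [sh sE]]]]]] := hs z.1 I.
have [_ [_ tz]] := hS z Sz.
exists i, i, (fst @^-1` U), (fun y => (y.1, (h y.1 : R) *: y.2)).
have oU' : open ((fst : E * E -> E) @^-1` U).
  by apply: open_comp => // y _; exact: cvg_fst.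
split; last split.
- split=> // -[x a] /= Ux; have ix := Ui _ Ux.
  have [dx ex] := chart_imgP hM ix.
  exists (chart_inv A i x, tvec i x a); first by split=> //; exact: tvec_tangent.
  by rewrite /= ex tvec_self.
- by move=> k; apply: Ck_fst_scale.
move=> [x a] /= Ux _; have ix := Ui _ Ux; have [dx ex] := chart_imgP hM ix.
have [_ sx] := sE x Ux I.
split; first by split=> //; apply: is_tangentZ; exact: tvec_tangent.
by rewrite ex fibZE tvec_self // -sx.
Qed.

End FibreScale.

(** * The metric along curves *)

Section Metric.
Context {R : realType} {n : nat} {M : topologicalType}.
Context {A : charts 'rV[R]_n M} (hM : smooth_manifold A).
Context {g : bilinear_field A} (hg : riemannian g).
Local Notation E := 'rV[R]_n.
Implicit Types (i : chart_idx A) (p : M) (u v w : fib A).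
Implicit Types (c : R^o -> M * fib A).

Lemma metricC p v w :
  is_tangent A p v -> is_tangent A p w -> g p v w = g p w v.
Proof. by case: hg => + _ _ _; apply. Qed.

Lemma metricPl p (k : R) u v w :
  is_tangent A p u -> is_tangent A p v -> is_tangent A p w ->
  g p (k *: u + v) w = k * g p u w + g p v w.
Proof. by case: hg => _ + _ _; apply. Qed.

Lemma metricPr p (k : R) u v w :
  is_tangent A p u -> is_tangent A p v -> is_tangent A p w ->
  g p w (k *: u + v) = k * g p w u + g p w v.
Proof.
move=> tu tv tw; have tkuv := is_tangentP k tu tv.
by rewrite (metricC tw tkuv) metricPl // (metricC tu tw) (metricC tv tw).
Qed.

Lemma metric0l p w : is_tangent A p w -> g p 0 w = 0.
Proof.
move=> tw; have t0 := @is_tangent0 _ _ _ A p.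
have := metricPl 1 t0 t0 tw.
by rewrite scaler0 addr0 mul1r => /eqP; rewrite -subr_eq subrr => /eqP.
Qed.

Lemma metricZ p (k : R) v w : is_tangent A p v -> is_tangent A p w ->
  g p (k *: v) (k *: w) = k ^+ 2 * g p v w.
Proof.
move=> tv tw; have t0 := @is_tangent0 _ _ _ A p; have tkw := is_tangentZ k tw.
rewrite -[k *: v]addr0 metricPl // metric0l // addr0.
rewrite -[k *: w]addr0 metricPr // (metricC tv t0) metric0l // addr0.
by rewrite mulrA expr2.
Qed.

(** For [v] nonzero, the reflection in the hyperplane orthogonal to [v]. *)
Definition reflection p v w : fib A := - (2 * g p w v / g p v v) *: v + w.

Lemma reflection_isometry p v w u : is_tangent A p v -> is_tangent A p w ->
  is_tangent A p u -> g p v v != 0 ->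
  g p (reflection p v w) (reflection p v u) = g p w u.
Proof.
move=> tv tw tu v0; rewrite /reflection.
rewrite metricPl ?metricPr //; last exact: is_tangentP.
by rewrite (metricC tv tu); field.
Qed.

Let metric_in i (y a b : E) : R^o :=
  g (chart_inv A i y) (tvec i y a) (tvec i y b).

(** Differentiating the squared length of a vector field along a curve gives
    twice its product with its covariant derivative.  In a chart, the squared
    length is [metric_in i (a t) (b t) (b t)] where [a] and [b] are the base and
    fibre components; metric compatibility with constant vector fields gives the
    derivative in [t] with both vectors fixed, and [is_derive_apply] is used
    once for each of them. *)
Lemma metric_derivative (Gamma : christoffel A) c :
  metric_compatible g Gamma -> linear_connection Gamma -> derivable_curve c ->
  let K := connector Gamma (c 0) (velocity (tangent A) c) in
  is_derive (0 : R^o) 1 (fun t : R^o => g (c t).1 (c t).2 (c t).2 : R^o)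
    (2 * g (c 0).1 K (c 0).2).
Proof.
move=> hmc hG hc K; have [i ci] := hc; have [nc da db] := ci.
have [di tc] := nbhs_singleton nc.
have tK : is_tangent A (c 0).1 K := connector_tangent hM hG hc.
pose a := base_coord i c; pose b := fibre_coord i c.
have ix : chart_img i (a 0) by exact: chart_img_map.
have near_img : \forall t \near (0 : R^o), chart_img i (a t).
  by apply: filterS nc => t [dit _]; exact: chart_img_map.
have linl y (k : R) e e' e'' : chart_img i y ->
    metric_in i y (k *: e + e') e'' =
    k *: metric_in i y e e'' + metric_in i y e' e''.
  move=> iy; rewrite /metric_in tvecP // metricPl //; exact: tvec_tangent.
have linr y (k : R) e e' e'' : chart_img i y ->
    metric_in i y e'' (k *: e + e') =
    k *: metric_in i y e'' e + metric_in i y e'' e'.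
  move=> iy; rewrite /metric_in tvecP // metricPr //; exact: tvec_tangent.
have dcst e e' : is_derive (0 : R^o) 1 (fun t => metric_in i (a t) e e')
    (metric_in i (a 0) (Gamma i (a 0) ('D_1 a 0) e) e' +
     metric_in i (a 0) e (Gamma i (a 0) ('D_1 a 0) e')).
  have dm : differentiable (fun y => metric_in i y e e') (a 0).
    by case: hg => _ _ _ /(_ i e e' 1%N) [+ _]; apply.
  have := is_derive_comp (derivableP da) dm.
  have smooth_cst (z : E) : smooth (chart_img i) (cst z : E -> E).
    by move=> k; exact: Ck_cst.
  have := hmc i (cst ('D_1 a 0)) (cst e) (cst e') (a 0)
    (smooth_cst _) (smooth_cst _) (smooth_cst _) ix.
  rewrite /covariant !derive_cst !add0r /= => <- ?.
  by rewrite (deriveE _ dm).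
have dleft e' : is_derive (0 : R^o) 1 (fun t => metric_in i (a t) (b t) e')
    (metric_in i (a 0) ('D_1 b 0) e' +
     (metric_in i (a 0) (Gamma i (a 0) ('D_1 a 0) (b 0)) e' +
      metric_in i (a 0) (b 0) (Gamma i (a 0) ('D_1 a 0) e'))).
  apply: (is_derive_apply (Phi := fun t e => metric_in i (a t) e e')
    _ (fun e => dcst e e') (derivableP db)).
  by apply: filterS near_img => t it k e e''; exact: linl.
have near_linr : \forall t \near (0 : R^o), forall (k : R) e e',
    metric_in i (a t) (b t) (k *: e + e') =
    k *: metric_in i (a t) (b t) e + metric_in i (a t) (b t) e'.
  by apply: filterS near_img => t it k e e'; exact: linr.
have dboth := is_derive_apply (Phi := fun t e => metric_in i (a t) (b t) e)
    near_linr dleft (derivableP db).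
apply: near_eq_is_derive (is_derive_eq dboth _).
- near=> t; have [dit tt] : chart_dom A i (c t).1 /\ is_tangent A (c t).1 (c t).2.
    by near: t.
  by rewrite /metric_in chart_invK // /b /fibre_coord -(tangent_tvec hM tt dit).
have eb : tvec i (a 0) (b 0) = (c 0).2 by rewrite -(tangent_tvec hM tc di).
have eK : tvec i (a 0) ('D_1 b 0 + Gamma i (a 0) ('D_1 a 0) (b 0)) = K.
  by rewrite -(connectorE Gamma ci) -(tangent_tvec hM tK di).
have := linl (a 0) 1 ('D_1 b 0) (Gamma i (a 0) ('D_1 a 0) (b 0)) (b 0) ix.
have := linr (a 0) 1 ('D_1 b 0) (Gamma i (a 0) ('D_1 a 0) (b 0)) (b 0) ix.
rewrite !scale1r /metric_in eb eK /a /base_coord chart_invK //.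
rewrite (metricC tc tK) => e1 e2; rewrite mulr_natl mulr2n {1}e1 e2.
by rewrite [RHS]addrAC !addrA.
Unshelve. all: by end_near.
Qed.

(** The heart of the proof.  Along [c] the derivative of [r] is determined by
    the covariant derivative [K], as [c] stays in the sphere bundle; the
    Leibniz term of the rescaled curve, whose factor is the derivative of
    [r^-2], is therefore exactly the one that reflects [K]. *)
Lemma connector_sphere_scale (Gamma : christoffel A) (r : M -> R) c :
  levi_civita g Gamma -> smooth_on A (real_line R) [set: M] r ->
  (forall p, 0 < r p) -> derivable_curve c ->
  (\forall t \near (0 : R^o), g (c t).1 (c t).2 (c t).2 = r (c t).1 ^+ 2) ->
  let f := fibre_scale (fun p => (r p)^-1 ^+ 2) in
  let K := connector Gamma (c 0) (velocity (tangent A) c) in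
  derivable_curve (f \o c) /\
  connector Gamma (f (c 0)) (velocity (tangent A) (f \o c)) =
  (r (c 0).1)^-1 ^+ 2 *: reflection (c 0).1 (c 0).2 K.
Proof.
move=> [hG _ hmc] sr r0 hc nr f K.
pose rho (t : R^o) : R^o := r (c t).1; pose r' : R := 'D_1 rho 0.
have dr : is_derive (0 : R^o) 1 rho r' := derivableP (smooth_on_derivable hM sr hc).
have rn0 : r (c 0).1 != 0 by rewrite gt_eqF.
have gK : g (c 0).1 K (c 0).2 = r (c 0).1 * r'.
  have [_ e] := metric_derivative hmc hG hc.
  have [_ e'] := is_derive_scale dr dr.
  have : 2 * g (c 0).1 K (c 0).2 = r (c 0).1 * r' + r' * r (c 0).1.
    by rewrite -e -[RHS]e'; apply: near_eq_derive; apply: filterS nr => t ->.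
  move=> e2; apply: (@mulfI _ 2); first by rewrite pnatr_eq0.
  by rewrite e2; ring.
have dri : is_derive (0 : R^o) 1 (fun t : R^o => (r (c t).1)^-1 : R^o)
    (- (r (c 0).1) ^- 2 * r').
  have [dr1 _] := dr.
  by apply: DeriveDef; [exact: derivableV|rewrite deriveV].
have [df ->] := connector_scale hM hG hc (is_derive_scale dri dri).
split; first exact: df.
rewrite /reflection [RHS]scalerDr [RHS]addrC [X in _ = _ + X]scalerA.
congr (_ *: _ + _ *: _).
rewrite gK (nbhs_singleton nr) /GRing.scale /=; by field.
Qed.
End Metric.

(** * The isometry *)

Theorem corollary2p4 (R : realType) (n : nat) (M : topologicalType)
    (A : charts 'rV[R]_n M) (g : bilinear_field A) (Gamma : christoffel A)
    (r : M -> R)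
    (hn : (3 <= n)%N)
    (hM : smooth_manifold A)
    (hconn : connected [set: M])
    (hg : riemannian g)
    (hLC : levi_civita g Gamma)
    (hr : smooth_on A (real_line R) [set: M] r)
    (hr0 : forall p, 0 < r p) :
  isometric (sphere_bundle g r) (sasaki g Gamma)
            (sphere_bundle g (fun p => (r p)^-1))
            (lift_metric g Gamma (fun=> 1) (fun p => r p ^+ 4)).
Proof.
have rn0 p : r p != 0 by rewrite gt_eqF.
have in_points s : sphere_bundle g s `<=` points (tangent A) by move=> u [].
pose shrink := fibre_scale (A := A) (fun p => (r p)^-1 ^+ 2).
pose stretch := fibre_scale (A := A) (fun p => r p ^+ 2).
have scale_sphere (s t : M -> R) u : sphere_bundle g s u ->
    sphere_bundle g (fun p => t p ^+ 2 * s p)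
      (fibre_scale (fun p => t p ^+ 2) u).
  move=> [[i [di tu]] gu]; split; last first.
    by rewrite /= (metricZ hg _ tu tu) gu [RHS]exprMn.
  by exists i; split=> //; exact: is_tangentZ.
exists shrink, stretch; split.
- move=> u Su; split; last first.
    case: u {Su} => p v; rewrite /stretch /shrink /fibre_scale /= scalerA.
    by rewrite -exprMn divff // expr1n scale1r.
  have := scale_sphere r (fun p => (r p)^-1) u Su.
  rewrite (_ : (fun p => _) = (fun p => (r p)^-1)) //.
  by apply/funext => p; rewrite expr2 -mulrA mulVf // mulr1.
- move=> u Su; split; last first.
    case: u {Su} => p v; rewrite /stretch /shrink /fibre_scale /= scalerA.
    by rewrite -exprMn mulVf // expr1n scale1r.
  have := scale_sphere (fun p => (r p)^-1) r u Su.
  rewrite (_ : (fun p => _) = r) //.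
  by apply/funext => p; rewrite expr2 -mulrA divff // mulr1.
- apply: smooth_fibre_scale => //; apply: smooth_on_sqr.
  exact: smooth_on_inv.
- by apply: smooth_fibre_scale => //; exact: smooth_on_sqr.
move=> c d [e e0 [sc Sc]] [e' e'0 [sd Sd]] cd.
have hc := smooth_curve_derivable e0 sc.
have hd := smooth_curve_derivable e'0 sd.
have norm_c : \forall t \near (0 : R^o),
    g (c t).1 (c t).2 (c t).2 = r (c t).1 ^+ 2.
  by apply: filterS (nbhsx_ballx _ _ e0) => t /Sc[].
have norm_d : \forall t \near (0 : R^o),
    g (d t).1 (d t).2 (d t).2 = r (d t).1 ^+ 2.
  by apply: filterS (nbhsx_ballx _ _ e'0) => t /Sd[].
have [hfc Kc] := connector_sphere_scale hM hg hLC hr hr0 hc norm_c.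
have [hfd Kd] := connector_sphere_scale hM hg hLC hr hr0 hd norm_d.
have [hG _ _] := hLC.
have tKc := connector_tangent hM hG hc; have tKd := connector_tangent hM hG hd.
have gv := nbhs_singleton norm_c.
have [[i [_ tv]] _] := Sc _ (ballxx _ e0).
have dpi_shrink k : derivable_curve k -> derivable_curve (shrink \o k) ->
    dpi (shrink (k 0)) (velocity (tangent A) (shrink \o k)) =
    dpi (k 0) (velocity (tangent A) k).
  by move=> hk hfk; rewrite (dpi_velocity hM hk) -(dpi_velocity hM hfk).
have dpi_c := dpi_shrink c hc hfc; have dpi_d := dpi_shrink d hd hfd.
rewrite -cd in Kd tKd dpi_d.
(* [gH] compares the horizontal parts, [gV] the vertical ones *)
have gH := congr2 (g (c 0).1) dpi_c dpi_d.
have gv0 : g (c 0).1 (c 0).2 (c 0).2 != 0 by rewrite gv expf_neq0.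
have gV := etrans (congr2 (g (c 0).1) Kc Kd)
  (metricZ hg _ (is_tangentP _ tv tKc) (is_tangentP _ tv tKd)).
have {}gV := etrans gV (congr1 _ (reflection_isometry hg tv tKc tKd gv0)).
have weight (x b : R) : x != 0 -> x ^+ 4 * (x^-1 ^+ 2 ^+ 2 * b) = 1 * b.
  by move=> x0; field.
have {}gV := etrans (congr1 ( *%R (r (c 0).1 ^+ 4)) gV) (weight _ _ (rn0 _)).
(* both metrics have weight 1 on the horizontal part, and so has the Sasaki
   metric on the vertical part *)
refine (congr2 (fun x y => 1 * x + y) gH gV).
Qed.
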